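(* Consider an instance of $\texttt{SoftCumulativeSum}$ with nonempty activity set $A$, current domains $D(\cdot)$, horizon $m$ and limits $ideal\_capa\le max\_capa$. Let $$LB_1=\sum_{t\in\{0,\dots,m-1\}}\min(D(costVar[t])),\qquad LB_2=LB_1+\max_{(a_i,a_j)}\mathrm{Inc}_{(a_i,a_j)},$$ where the maximum is over all pairs $(a_i,a_j)\in A^2$ with $\min(D(start[a_i]))<\max(D(end[a_j]))$. If $LB_2>\min(D(cost))$, then all values in $[\min(D(cost)),\,LB_2[$ can be removed from $D(cost)$; that is, no solution of $\texttt{SoftCumulativeSum}$ with respect to the current domains assigns to $cost$ a value in $[\min(D(cost)),\,LB_2[$.
   Context: Time is discrete: points in time are integers, and $[x,y[$ denotes $\{t\in\mathbb{Z}: x\le t<y\}$. Each variable $x$ is integer-valued with a current finite nonempty domain $D(x)$, with minimum $\min(D(x))$ and maximum $\max(D(x))$. $A=\{a_1,\dots,a_n\}$ is a set of non-preemptive activities scheduled between time $0$ and $m$ (starts and ends lie in $\{0,\dots,m\}$). Each $a\in A$ has variables $start[a]$, $dur[a]$ (duration), $end[a]$ and $res[a]$ (amount of resource consumed, or height). Each activity consumes a positive amount of the resource (durations and heights are positive). For an assignment of the variables, the cumulated height at time $t$ is $h_t=\sum_{a\in A,\ start[a]\le t<end[a]}\min(D(res[a]))$. $\texttt{SoftCumulativeSum}$ has two integer resource limits $ideal\_capa\le max\_capa$, an integer variable $costVar[t]$ for each point in time $t\in\{0,\dots,m-1\}$, and an integer variable $cost$. It enforces: (C1) $start[a]+dur[a]=end[a]$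 for every $a\in A$; (C2) $h_t\le max\_capa$ for every $t$; (C3) $costVar[t]=\max(0,h_t-ideal\_capa)$ for every $t \in\{0,\dots,m-1\}$; and $cost=\sum_{t\in\{0,\dots,m-1\}}costVar[t]$. A solution with respect to the current domains is an assignment of each variable to a value of its current domain satisfying all these constraints. A value $v$ ''can be removed'' from $D(x)$ if no solution assigns $v$ to $x$. For $a_i,a_j\in A$ (possibly equal) with $\min(D(start[a_i]))<\max(D(end[a_j]))$, define: - $I_{(a_i,a_j)}=[\min(D(start[a_i])),\max(D(end[a_j]))[$; - $S_{(a_i,a_j)}=\{a\in A:\ \min(D(start[a_i]))\le\min(D(start[a]))<\max(D(end[a_j]))\}$; - for $a\in S_{(a_i,a_j)}$, $W_{(a_i,a_j)}(a)=\min(D(res[a]))\cdot\min\bigl[\min(D(dur[a])),\ \max\bigl(0,\ \max(D(end[a_j]))-\max(D(start[a]))\bigr)\bigr]$; - $lb_{1(a_i,a_j)}=\sum_{t\in I_{(a_i,a_j)}}\min(D(costVar[t]))$; - $\mathrm{FreeArea}_{(a_i,a_j)}=\bigl(\max(D(end[a_j]))-\min(D(start[a_i]))\bigr)\cdot ideal\_capa$; - $\mathrm{Inc}_{(a_i,a_j)}=\sum_{a\in S_{(a_i,a_j)}}W_{(a_i,a_j)}(a)-\mathrm{FreeArea}_{(a_i,a_j)}-lb_{1(a_i,a_j)}$. *)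

(* Defs.v *)
From HB Require Import structures.
From mathcomp Require Import all_boot all_order all_algebra finmap.
Set Implicit Arguments.
Unset Strict Implicit.
Unset Printing Implicit Defensive.
Import Order.TTheory GRing.Theory Num.Theory.
Local Open Scope ring_scope.

Record domain := Domain {
  dom_set :> {fset int};
  dom_neq0 : dom_set != fset0 }.

(* The default [head 0 D] is an element of D since D is nonempty; see
   [dminP] and [dmaxP]. *)
Definition dmin (D : domain) : int :=
  \big[Num.min/head 0 (enum_fset D)]_(x <- enum_fset D) x.

Definition dmax (D : domain) : int :=
  \big[Num.max/head 0 (enum_fset D)]_(x <- enum_fset D) x.

(* One object of type X per variable of the constraint: [vars A m domain] is a
   choice of current domains, [vars A m int] is an assignment. *)
Record vars (A : finType) (m : nat) (X : Type) := Vars {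
  start : A -> X;
  dur : A -> X;
  end_ : A -> X;
  res : A -> X;
  costVar : 'I_m -> X;
  cost : X }.

Record softCumulativeSum (A : finType) (m : nat) := SoftCumulativeSum {
  ideal_capa : int;
  max_capa : int;
  dom : vars A m domain;
  ideal_le_max : ideal_capa <= max_capa;
  start_horizon : forall a x, x \in dom_set (start dom a) -> 0 <= x <= m%:Z;
  end_horizon : forall a x, x \in dom_set (end_ dom a) -> 0 <= x <= m%:Z;
  dur_gt0 : forall a x, x \in dom_set (dur dom a) -> 0 < x;
  res_gt0 : forall a x, x \in dom_set (res dom a) -> 0 < x }.

Section SoftCumulativeSum.
Variables (A : finType) (m : nat) (P : softCumulativeSum A m).
Local Notation D := (dom P).
Implicit Types (s : vars A m int) (a ai aj : A).

Definition in_domains s : Prop :=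
  [/\ forall a, start s a \in dom_set (start D a),
      forall a, dur s a \in dom_set (dur D a),
      forall a, end_ s a \in dom_set (end_ D a) &
      forall a, res s a \in dom_set (res D a)] /\
  (forall t, costVar s t \in dom_set (costVar D t)) /\
  cost s \in dom_set (cost D).

(* The height contributed by an activity is the minimum of the domain of its
   resource variable, not the assigned value [res s a]. *)
Definition height s (t : int) : int :=
  \sum_(a | start s a <= t < end_ s a) dmin (res D a).

Definition solution s : Prop :=
  [/\ in_domains s,
      forall a, start s a + dur s a = end_ s a,
      forall t : int, height s t <= max_capa P,
      forall t : 'I_m,
        costVar s t = Num.max 0 (height s (t : nat)%:Z - ideal_capa P) &
      cost s = \sum_(t < m) costVar s t].

(* Variables are represented by the projections of [vars A m int]. *)
Definition removable (x : vars A m int -> int) (v : int) : Prop :=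
  ~ exists s, solution s /\ x s = v.

Definition valid_pair ai aj : bool := dmin (start D ai) < dmax (end_ D aj).

Definition inI ai aj (t : int) : bool :=
  dmin (start D ai) <= t < dmax (end_ D aj).

Definition actS ai aj : {set A} := [set a | inI ai aj (dmin (start D a))].

Definition W ai aj a : int :=
  dmin (res D a) *
  Num.min (dmin (dur D a))
          (Num.max 0 (dmax (end_ D aj) - dmax (start D a))).

(* By [start_horizon] and [end_horizon] the interval I lies in {0, ..., m-1},
   so restricting the index to ['I_m] drops no point of I. *)
Definition lb1 ai aj : int :=
  \sum_(t < m | inI ai aj (t : nat)%:Z) dmin (costVar D t).

Definition FreeArea ai aj : int :=
  (dmax (end_ D aj) - dmin (start D ai)) * ideal_capa P.

Definition Inc ai aj : int :=
  \sum_(a in actS ai aj) W ai aj a - FreeArea ai aj - lb1 ai aj.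

(* Maximum over the valid pairs, see [maxIncP]; Inc may be negative, so the fold
   starts from the value at a valid pair.  If there is no valid pair, the
   maximum is undefined and 0 is a dummy value. *)
Definition maxInc : int :=
  if [pick p : A * A | valid_pair p.1 p.2] is Some p0 then
    \big[Num.max/Inc p0.1 p0.2]_(p : A * A | valid_pair p.1 p.2) Inc p.1 p.2
  else 0.

Definition LB1 : int := \sum_(t < m) dmin (costVar D t).

Definition LB2 : int := LB1 + maxInc.

End SoftCumulativeSum.

Lemma head_dom (D : domain) : head 0 (enum_fset D) \in dom_set D.
Proof.
case: D => D /= /fset0Pn[x]; suff: x \in enum_fset D ->
  head 0 (enum_fset D) \in enum_fset D by [].
by case: (enum_fset D) => [|y s] //= _; rewrite mem_head.
Qed.

Lemma dminP (D : domain) :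
  dmin D \in dom_set D /\ (forall x, x \in dom_set D -> dmin D <= x).
Proof.
split; last by move=> x xD; rewrite /dmin; exact: (ge_bigmin_seq _ x xpredT id).
rewrite /dmin big_seq; elim/big_ind: _ => //; first exact: head_dom.
by move=> x y; rewrite /Order.min; case: ifP.
Qed.

Lemma dmaxP (D : domain) :
  dmax D \in dom_set D /\ (forall x, x \in dom_set D -> x <= dmax D).
Proof.
split; last by move=> x xD; rewrite /dmax; exact: (le_bigmax_seq _ x xpredT id).
rewrite /dmax big_seq; elim/big_ind: _ => //; first exact: head_dom.
by move=> x y; rewrite /Order.max; case: ifP.
Qed.

Lemma maxIncP (A : finType) (m : nat) (P : softCumulativeSum A m) (bi bj : A) :
  valid_pair P bi bj ->
  (exists ai aj, valid_pair P ai aj /\ maxInc P = Inc P ai aj) /\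
  (forall ai aj, valid_pair P ai aj -> Inc P ai aj <= maxInc P).
Proof.
move=> vb; rewrite /maxInc; case: pickP => [p0 v0|/(_ (bi, bj))]; last by rewrite vb.
split=> [|ai aj vij]; last first.
  exact: (@le_bigmax_cond _ _ _ _ (ai, aj) _ (fun p : A * A => Inc P p.1 p.2)).
elim/big_ind: _ => [|x y hx hy|p vp]; first by exists p0.1, p0.2.
- by rewrite /Order.max; case: ifP.
- by exists p.1, p.2.
Qed.

(* Main.v *)
(** In a solution, an activity a of S starts inside I at or before
    max D(start[a]), so it occupies at least W(a) of the resource within I
    whatever its start time.  Summing over S bounds the total height over I
    from below; as costVar[t] >= h_t - ideal_capa, the sum of costVar over I is at
    least Inc + lb1.  Outside I, costVar[t] is bounded by its minimum.  A pair
    (a, a) is always valid when a solution exists, so maxInc is a true maximum. *)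
Require Import Defs.
From HB Require Import structures.
From mathcomp Require Import all_boot all_order all_algebra finmap.
From mathcomp Require Import zify.
Import Order.TTheory GRing.Theory Num.Theory.
Local Open Scope ring_scope.

(** The index runs over ['I_m], so the interval is cut at [m] on the right; [0 <= x] prevents a cut
    on the left, and the outer maximum covers an empty interval. *)
Lemma sum_const_itv (m : nat) (x y c : int) : 0 <= x ->
  \sum_(t < m | x <= (t : nat)%:Z < y) c
  = c * Num.max 0 (Num.min y m%:Z - x).
Proof.
move=> x0; transitivity (c * \sum_(t < m | x <= (t : nat)%:Z < y) (1 : int)).
  by rewrite mulr_sumr; apply: eq_bigr => t _; rewrite mulr1.
congr (c * _); rewrite big_mkcond /=.
elim: m => [|m IHm]; first by rewrite big_ord0; lia.
by rewrite big_ord_recr /= IHm; case: ifP; lia.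
Qed.

Section Solution.
Variables (A : finType) (m : nat) (P : softCumulativeSum A m).
Variable s : vars A m int.
Hypothesis sol : solution P s.
Local Notation D := (dom P).
Implicit Types a ai aj : A.

Lemma solution_start_bounds a :
  dmin (start D a) <= start s a <= dmax (start D a).
Proof.
have [[[/(_ a) ds _ _ _] _] _ _ _ _] := sol.
by rewrite (dminP _).2 // (dmaxP _).2.
Qed.

Lemma solution_dur_ge a : dmin (dur D a) <= dur s a.
Proof. by have [[[_ /(_ a) dd _ _] _] _ _ _ _] := sol; apply: (dminP _).2. Qed.

Lemma solution_end_le a : end_ s a <= dmax (end_ D a).
Proof. by have [[[_ _ /(_ a) de _] _] _ _ _ _] := sol; apply: (dmaxP _).2. Qed.

(** Durations are positive, so the assigned start lies strictly before the assigned end. *)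
Lemma solution_valid_pair a : valid_pair P a a.
Proof.
have [_ /(_ a) e _ _ _] := sol.
have := dur_gt0 (dminP (dur D a)).1.
have := solution_start_bounds a.
have := solution_dur_ge a; have := solution_end_le a.
rewrite /valid_pair; lia.
Qed.

Lemma W_le_height_itv ai aj a : a \in actS P ai aj ->
  W P ai aj a <= \sum_(t < m | inI P ai aj (t : nat)%:Z &&
                      (start s a <= (t : nat)%:Z < end_ s a)) dmin (res D a).
Proof.
rewrite inE /inI => aS; have [_ /(_ a) se _ _ _] := sol.
have st := solution_start_bounds a; have du := solution_dur_ge a.
have d0 := dur_gt0 (dminP (dur D a)).1.
have r0 := res_gt0 (dminP (res D a)).1.
have := start_horizon (dminP (start D a)).1.
have := end_horizon (dmaxP (end_ D aj)).1 => em sm.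
(* Since [a] is in S, it starts no earlier than I does, so only the right end of I can cut it. *)
rewrite (eq_bigl (fun t : 'I_m =>
  start s a <= (t : nat)%:Z < Num.min (dmax (end_ D aj)) (end_ s a))); last first.
  by move=> t; lia.
rewrite sum_const_itv; last by lia.
by rewrite /W ler_pM2l //; lia.
Qed.

Lemma sum_W_le_height ai aj :
  \sum_(a in actS P ai aj) W P ai aj a
  <= \sum_(t < m | inI P ai aj (t : nat)%:Z) height P s (t : nat)%:Z.
Proof.
rewrite /height; under [leRHS]eq_bigr do rewrite big_mkcond /=.
(* With the activity as outer index, those outside S contribute nonnegative terms because heights
   are positive. *)
rewrite exchange_big /= [leLHS]big_mkcond /=; apply: ler_sum => a _.
rewrite -big_mkcondr /=; case: ifP => [/W_le_height_itv //|_].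
by apply: sumr_ge0 => t _; apply: ltW (res_gt0 (dminP _).1).
Qed.

Lemma Inc_lb1_le_costVar ai aj : valid_pair P ai aj ->
  Inc P ai aj + lb1 P ai aj
  <= \sum_(t < m | inI P ai aj (t : nat)%:Z) costVar s t.
Proof.
move=> v; have [_ _ _ cv _] := sol.
have cvge : \sum_(t < m | inI P ai aj (t : nat)%:Z)
      (height P s (t : nat)%:Z - ideal_capa P)
    <= \sum_(t < m | inI P ai aj (t : nat)%:Z) costVar s t.
  by apply: ler_sum => t _; rewrite cv le_max lexx orbT.
apply: le_trans cvge; rewrite sumrB /inI sum_const_itv; last first.
  by have := start_horizon (dminP (start D ai)).1; lia.
(* Validity and the horizon make both cut-offs inactive, so [ideal_capa] sums over I to exactly
   [FreeArea]. *)
have -> : Num.max 0 (Num.min (dmax (end_ D aj)) m%:Z - dmin (start D ai))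
        = dmax (end_ D aj) - dmin (start D ai).
  by have := end_horizon (dmaxP (end_ D aj)).1; move: v; rewrite /valid_pair; lia.
by rewrite /Inc /FreeArea subrK mulrC lerD2r sum_W_le_height.
Qed.

Lemma LB1_Inc_le_cost ai aj : valid_pair P ai aj ->
  LB1 P + Inc P ai aj <= cost s.
Proof.
move=> v; have [[_ [dcv _]] _ _ _ ->] := sol.
(* The part of [LB1] over I is [lb1], which cancels the [lb1] subtracted in [Inc]. *)
rewrite /LB1 (bigID (fun t : 'I_m => inI P ai aj (t : nat)%:Z)) /=.
rewrite [leRHS](bigID (fun t : 'I_m => inI P ai aj (t : nat)%:Z)) /=.
rewrite addrAC lerD //.
  by rewrite addrC Inc_lb1_le_costVar.
by apply: ler_sum => t _; apply: (dminP _).2.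
Qed.

End Solution.

Theorem mainTheorem4 (A : finType) (m : nat) (P : softCumulativeSum A m)
    (A_gt0 : (0 < #|A|)%N) :
  dmin (cost (dom P)) < LB2 P ->
  forall v : int, dmin (cost (dom P)) <= v < LB2 P ->
    removable P (@cost A m int) v.
Proof.
move=> _ v /andP[_ v_lt] [s [sol sv]].
have /card_gt0P[a _] := A_gt0.
(* As [maxInc] is attained, the cost bound for one pair already contradicts [v < LB2 P]. *)
have [[ai [aj [vij maxE]]] _] := maxIncP (solution_valid_pair _ _ _ _ sol a).
have := LB1_Inc_le_cost _ _ _ _ sol _ _ vij.
by rewrite -maxE sv leNgt v_lt.
Qed.
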